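(* Let $A$ be a real $2\times 2$ matrix, $\eta\in\mathbb{R}^2\setminus\{0\}$, and $\Omega=[u^-,u^+]$ with $u^-<u^+$. If $\operatorname{tr}A=0$ and $\det A>0$, then the linear control system $\dot v=Av+u\eta$, $u\in\Omega$, on $\mathbb{R}^2$ is controllable.
   Context: Control functions: $\mathcal{U}$ is the set of all piecewise constant functions $\mathbf{u}:\mathbb{R}\to\Omega$ (finitely many discontinuities on each bounded interval). For $v\in\mathbb{R}^2$ and $\mathbf{u}\in\mathcal{U}$, the solution $s\in\mathbb{R}\mapsto\varphi(s,v,\mathbf{u})$ is the unique continuous, piecewise differentiable curve with $\varphi(0,v,\mathbf{u})=v$ and $\frac{d}{ds}\varphi(s,v,\mathbf{u})=A\varphi(s,v,\mathbf{u})+\mathbf{u}(s)\eta$ (away from the discontinuities of $\mathbf{u}$). The positive orbit of $v$ is $\mathcal{O}^+(v)=\{\varphi(s,v,\mathbf{u}) : s\ge 0,\ \mathbf{u}\in\mathcal{U}\}$. A control set of the system is a subset $D\subset\mathbb{R}^2$ such that: (a) for every $v\in D$ there exists $\mathbf{u}\in\mathcal{U}$ with $\varphi(s,v,\mathbf{u})\in D$ for all $s\geq 0$; (b) for every $v\in D$, $D\subset\overline{\mathcal{O}^+(v)}$; (c) $D$ is maximal with respect to set inclusion among sets satisfying (a) and (b). The system is called controllable if $D=\mathbb{R}^2$ is a control set of it. *)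

(* Defs.v *)
From HB Require Import structures.
From mathcomp Require Import all_boot all_order all_algebra.
From mathcomp Require Import all_classical all_reals all_analysis.
Set Implicit Arguments.
Unset Strict Implicit.
Unset Printing Implicit Defensive.
Import Order.TTheory GRing.Theory Num.Theory.
Import numFieldNormedType.Exports.
Local Open Scope classical_set_scope.
Local Open Scope ring_scope.

Definition discontinuities (R : realType) (u : R -> R) : set R :=
  [set t | ~ {for t, continuous u}].

Definition piecewise_constant (R : realType) (u : R -> R) : Prop :=
  (forall a b : R, finite_set (`[a, b] `&` discontinuities u)) /\
  (forall a b : R, `]a, b[ `&` discontinuities u = set0 ->
     forall s t : R, s \in `]a, b[ -> t \in `]a, b[ -> u s = u t).

Definition control_functions (R : realType) (Omega : set R) : set (R -> R) :=
  [set u | piecewise_constant u /\ forall t : R, Omega (u t)].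

(* [solution A eta u v phi]: [phi] is the curve s |-> phi(s, v, u).  Piecewise
   differentiability is contained in the last clause, because the
   discontinuities of a control function are locally finite. *)
Definition solution (R : realType) (A : 'M[R]_2) (eta : 'cV[R]_2)
    (u : R -> R) (v : 'cV[R]_2) (phi : R -> 'cV[R]_2) : Prop :=
  [/\ continuous phi,
      phi 0 = v &
      forall s : R, ~ discontinuities u s ->
        is_derive s 1 phi (A *m phi s + u s *: eta)].

(* The solution for given [u] and [v] exists and is unique, so that quantifying
   existentially over [phi] here and in [control_set_a] amounts to evaluating
   the solution. *)
Definition positive_orbit (R : realType) (A : 'M[R]_2) (eta : 'cV[R]_2)
    (Omega : set R) (v : 'cV[R]_2) : set 'cV[R]_2 :=
  [set w | exists (s : R) (u : R -> R) (phi : R -> 'cV[R]_2),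
    [/\ 0 <= s, control_functions Omega u, solution A eta u v phi &
        w = phi s]].

Definition control_set_a (R : realType) (A : 'M[R]_2) (eta : 'cV[R]_2)
    (Omega : set R) (D : set 'cV[R]_2) : Prop :=
  forall v, D v ->
    exists (u : R -> R) (phi : R -> 'cV[R]_2),
      [/\ control_functions Omega u, solution A eta u v phi &
          forall s : R, 0 <= s -> D (phi s)].

Definition control_set_b (R : realType) (A : 'M[R]_2) (eta : 'cV[R]_2)
    (Omega : set R) (D : set 'cV[R]_2) : Prop :=
  forall v, D v -> D `<=` closure (positive_orbit A eta Omega v).

Definition control_set (R : realType) (A : 'M[R]_2) (eta : 'cV[R]_2)
    (Omega : set R) (D : set 'cV[R]_2) : Prop :=
  [/\ control_set_a A eta Omega D,
      control_set_b A eta Omega D &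
      forall E : set 'cV[R]_2,
        control_set_a A eta Omega E -> control_set_b A eta Omega E ->
        D `<=` E -> E = D].

Definition controllable (R : realType) (A : 'M[R]_2) (eta : 'cV[R]_2)
    (Omega : set R) : Prop :=
  control_set A eta Omega setT.

(* Main.v *)
(** Write w = sqrt (det A), so that A^2 = - w^2 by Cayley-Hamilton.  Under a
    constant control c every trajectory rotates, with period 2 pi / w, around
    the equilibrium c p, where p = - A^-1 eta.  Half-turns around c p and then
    around c' p compose to the translation by 2 (c' - c) p, so every translation
    along the line R p is achieved by finitely many of them.  As p and A p span
    the plane, any two points are joined by rotating the first one onto the
    line, translating along it, and rotating onto the second one. *)

Require Import Defs.
From HB Require Import structures.
From mathcomp Require Import all_boot all_order all_algebra.
From mathcomp Require Import all_classical all_reals all_analysis.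
From mathcomp Require Import ring lra.
Set Implicit Arguments.
Unset Strict Implicit.
Unset Printing Implicit Defensive.
Import Order.TTheory GRing.Theory Num.Theory.
Import numFieldNormedType.Exports.
Local Open Scope classical_set_scope.
Local Open Scope ring_scope.

(** * Preliminaries from real analysis *)

(** If [u] took two values on the interval, the intermediate value theorem would put a nondegenerate
    interval inside its range; that interval has positive Lebesgue measure, whereas a finite set is
    null. *)
Lemma finite_range_constant (R : realType) (u : R -> R) (a b : R) :
  finite_set (range u) -> `]a, b[ `&` discontinuities u = set0 ->
  forall s t : R, s \in `]a, b[ -> t \in `]a, b[ -> u s = u t.
Proof.
move=> fu; rewrite -subset0 => du.
suff H s t : s \in `]a, b[ -> t \in `]a, b[ -> s <= t -> u s = u t.
  by move=> s t sab tab; have [/H->|/ltW/H->] := leP s t.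
move=> /[!in_itv]/= /andP[as_ sb] /andP[at_ tb] st.
apply: contrapT => /eqP ust.
have cu : {within `[s, t], continuous u}.
  apply: continuous_in_subspaceT => x /[!inE]/= /[!in_itv]/= /andP[sx xt].
  apply: contrapT => nx; apply: (du x); split => //=.
  by rewrite in_itv /=; apply/andP; split; lra.
have sub : `[Num.min (u s) (u t), Num.max (u s) (u t)] `<=` range u.
  move=> y /= /[!in_itv]/= /(IVT st cu)[x _ <-]; exact: imageT.
have := countable_lebesgue_measure0
  (finite_set_countable (sub_finite_set sub fu)).
rewrite lebesgue_measure_itv/= lte_fin.
set x := Num.min _ _; set y := Num.max _ _.
have xy : x < y.
  by move: ust; rewrite /x /y neq_lt /Num.min /Num.max; case: ltgtP.
by rewrite xy => -[] /eqP; apply/negP; rewrite subr_eq0 gt_eqF.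
Qed.

Lemma is_derive_mx (R : realType) (m n : nat) (M : R -> 'M[R]_(m.+1, n.+1))
    (D : 'M[R]_(m.+1, n.+1)) (t : R) :
  (forall i j, is_derive t 1 (fun x => M x i j) (D i j)) -> is_derive t 1 M D.
Proof.
move=> H; have dM : derivable M t 1.
  by apply/derivable_mxP => i j; case: (H i j).
apply: DeriveDef => //; rewrite derive_mx//.
by apply/matrixP => i j; rewrite mxE; case: (H i j).
Qed.

Lemma is_derive_subr (R : realType) (V : normedModType R) (f : R -> V) (T t : R)
    (df : V) :
  is_derive (t - T) 1 f df -> is_derive t 1 (fun x => f (x - T)) df.
Proof.
have E : (fun h : R => h^-1 *: (f (h *: 1 + t - T) - f (t - T))) =
         (fun h : R => h^-1 *: (f (h *: 1 + (t - T)) - f (t - T))).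
  by apply/funext => h; rewrite addrA.
case=> df1 df2; apply: DeriveDef.
  by rewrite /derivable /= E.
by rewrite /derive /= E.
Qed.

Lemma near_eq_continuous_at (T U : topologicalType) (f g : T -> U) (t : T) :
  (\near t, f t = g t) -> {for t, continuous f} -> {for t, continuous g}.
Proof.
move=> fg; rewrite /prop_for /continuous_at (nbhs_singleton fg).
by apply: cvg_trans; apply: near_eq_cvg; apply: filterS fg.
Qed.

Lemma continuous_at_subr (R : realType) (U : topologicalType) (f : R -> U)
    (T t : R) :
  {for t, continuous (fun x => f (x - T))} <-> {for t - T, continuous f}.
Proof.
have cs (k x : R) : {for x, continuous (fun y : R => y + k)}.
  by apply: continuousD; [exact: cvg_id|exact: cst_continuous].
split=> cf; last by apply: (continuous_comp (cs (- T) t)).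
have -> : f = (fun x => f (x - T)) \o (fun y => y + T).
  by apply/funext => x /=; rewrite addrK.
by apply: continuous_comp (cs T _) _; rewrite subrK.
Qed.

(** The angle is confined to a half-turn, so the radius [r] may be negative: the lower half-plane is
    obtained from the upper one by changing its sign. *)
Lemma polar_coordinates (R : realType) (a b : R) :
  exists2 t, 0 <= t <= pi & exists r, a = r * cos t /\ b = r * sin t.
Proof.
wlog b0 : a b / 0 <= b => [H|].
  have [/H//|/ltW b0] := leP 0 b.
  have [|t tpi [r [ar br]]] := H (- a) (- b); first by rewrite oppr_ge0.
  by exists t => //; exists (- r); rewrite !mulNr -ar -br !opprK.
pose r := Num.sqrt (a ^+ 2 + b ^+ 2).
have r2 : r ^+ 2 = a ^+ 2 + b ^+ 2 by rewrite sqr_sqrtr ?addr_ge0 ?sqr_ge0.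
have : 0 <= r by exact: sqrtr_ge0.
rewrite le_eqVlt => /predU1P[r0|r0].
  exists 0; first by rewrite lexx pi_ge0.
  exists 0; rewrite !mul0r; move: r2; rewrite -r0 expr0n/= => /esym/eqP.
  by rewrite paddr_eq0 ?sqr_ge0// !sqrf_eq0 => /andP[/eqP-> /eqP->].
have ar : -1 <= a / r <= 1.
  rewrite ler_pdivlMr// ler_pdivrMr// mulN1r mul1r -ler_norml.
  by rewrite -sqrtr_sqr ler_wsqrtr// lerDl sqr_ge0.
have /acos_def[tpi ca] := ar; exists (acos (a / r)) => //; exists r.
have rc : r * cos (acos (a / r)) = a by rewrite ca mulrC divfK ?gt_eqF.
split=> //; apply/eqP.
(* Both sides are nonnegative, the sine because its angle lies in [0, pi], so comparing squares
   suffices. *)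
rewrite -(@eqrXn2 _ 2)// ?mulr_ge0 ?sin_ge0_pi// ?ltW//.
rewrite exprMn sin2cos2 mulrBr mulr1 -exprMn rc r2; apply/eqP; ring.
Qed.

(** * Motion under a constant control *)

Section harmonic_control.
Variables (R : realType) (A : 'M[R]_2) (w : R) (p : 'cV[R]_2).
Hypotheses (w_gt0 : 0 < w) (AA : A *m A = - (w ^+ 2)%:M).

Implicit Types (c s t : R) (v x : 'cV[R]_2) (l : seq (R * R)).

(** This is exp(s A) x, the exponential series being summed by means of A^2 = - w^2. *)
Definition rot (s : R) (x : 'cV[R]_2) : 'cV[R]_2 :=
  cos (w * s) *: x + (sin (w * s) / w) *: (A *m x).

(** The solution of y' = A (y - c p) that starts at [v]; its equilibrium is [c *: p]. *)
Definition flow (c s : R) (v : 'cV[R]_2) : 'cV[R]_2 :=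
  c *: p + rot s (v - c *: p).

Lemma mulmxAA x : A *m (A *m x) = - (w ^+ 2 *: x).
Proof. by rewrite mulmxA AA mulNmx mul_scalar_mx. Qed.

Lemma rot0 x : rot 0 x = x.
Proof. by rewrite /rot mulr0 cos0 sin0 mul0r scale0r addr0 scale1r. Qed.

Lemma rotD s t x : rot (s + t) x = rot s (rot t x).
Proof.
have w0 : w != 0 by rewrite gt_eqF.
rewrite /rot mulrDr cosD sinD mulmxDr -!scalemxAr mulmxAA.
by apply/matrixP => i j; rewrite !mxE; field.
Qed.

Lemma rot_half_turn x : rot (pi / w) x = - x.
Proof.
rewrite /rot mulrC divfK ?gt_eqF// cospi sinpi.
by rewrite mul0r scale0r addr0 scaleN1r.
Qed.

Lemma flow0 c v : flow c 0 v = v.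
Proof. by rewrite /flow rot0 addrC subrK. Qed.

Lemma flowD c s t v : flow c (s + t) v = flow c s (flow c t v).
Proof. by rewrite /flow rotD [c *: p + rot t _]addrC addrK. Qed.

Lemma is_derive_flow c s v :
  is_derive s 1 (fun s => flow c s v) (A *m (flow c s v - c *: p)).
Proof.
have w0 : w != 0 by rewrite gt_eqF.
rewrite {2}/flow addrAC subrr add0r /flow.
move: (v - c *: p) => x; rewrite /rot mulmxDr -!scalemxAr mulmxAA.
apply: is_derive_mx => i j.
have -> : (fun t => (c *: p + (cos (w * t) *: x +
                               sin (w * t) / w *: (A *m x))) i j) =
          (fun t => (c *: p) i j + (x i j *: cos (w * t) +
                                    ((A *m x) i j / w) *: sin (w * t))).
  by apply/funext => t; rewrite !mxE /GRing.scale /=; ring.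
have dw : is_derive s 1 ( *%R w) w.
  have := @is_deriveZ R R R id w s 1 1 _; rewrite /GRing.scale /= mulr1; exact.
have dc := is_derive1_comp (is_derive_cos (w * s)) dw.
have ds := is_derive1_comp (is_derive_sin (w * s)) dw.
apply: (@is_derive_eq _ _ _ _ _ _ _ (0 + (x i j *: (- sin (w * s) * w) +
  ((A *m x) i j / w) *: (cos (w * s) * w)))).
by rewrite !mxE /GRing.scale /=; field.
Qed.

Lemma continuous_flow c v : continuous (fun s => flow c s v).
Proof.
move=> s; apply: differentiable_continuous; apply/derivable1_diffP.
by case: (is_derive_flow c s v).
Qed.

(** * Concatenation of constant controls *)

Variable c0 : R.

(* A list of pairs (duration, value); the value [c0] applies after the last one
   and the first value extends to all negative times. *)
Fixpoint control (l : seq (R * R)) (t : R) : R :=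
  if l is (T, c) :: l' then if t < T then c else control l' (t - T) else c0.

Fixpoint curve (l : seq (R * R)) (v : 'cV[R]_2) (t : R) : 'cV[R]_2 :=
  if l is (T, c) :: l' then
    if t < T then flow c t v else curve l' (flow c T v) (t - T)
  else flow c0 t v.

Definition endpoint (l : seq (R * R)) (v : 'cV[R]_2) : 'cV[R]_2 :=
  foldl (fun x Tc => flow Tc.2 Tc.1 x) v l.

(** Gives empty and nonempty lists a common description near the start, for gluing the pieces on the
    two sides of a switching time. *)
Lemma control_initial l : all (fun Tc => 0 < Tc.1) l ->
  exists2 d, 0 < d & forall t, t < d ->
    control l t = control l 0 /\ forall v, curve l v t = flow (control l 0) t v.
Proof.
case: l => [|[T c] l] /=; first by exists 1.
by move=> /andP[T0 _]; exists T => // t tT; rewrite tT T0.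
Qed.

Lemma curve0 l v : all (fun Tc => 0 < Tc.1) l -> curve l v 0 = v.
Proof.
by move=> /control_initial[d d0 /(_ 0 d0)[_ ->]]; rewrite flow0.
Qed.

Lemma curve_endpoint l v : all (fun Tc => 0 < Tc.1) l ->
  exists2 s, 0 <= s & curve l v s = endpoint l v.
Proof.
elim: l v => [|[T c] l IH] v /=; first by exists 0 => //; rewrite flow0.
move=> /andP[T0 /IH]/(_ (flow c T v))[s s0 <-]; exists (s + T).
  by rewrite addr_ge0// ltW.
by rewrite addrK ltNge lerDr s0.
Qed.

Lemma control_in (B : set R) l t : B c0 -> (forall Tc, Tc \in l -> B Tc.2) ->
  B (control l t).
Proof.
move=> B0; elim: l t => [//|[T c] l IH] t Bl /=; case: ifP => _.
  exact: (Bl (T, c) (mem_head _ _)).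
by apply: IH => Tc Tcl; apply: Bl; rewrite inE Tcl orbT.
Qed.

(** Only [c0] and the listed values occur; this feeds [finite_range_constant]. *)
Lemma finite_range_control l : finite_set (range (control l)).
Proof.
have : finite_set [set` c0 :: map snd l] by exact: finite_seq.
apply: sub_finite_set => _ [t _ <-].
apply: (@control_in [set` c0 :: map snd l]) => /=; first exact: mem_head.
by move=> Tc Tcl; rewrite inE map_f ?orbT.
Qed.

Lemma near_control_lt T c l t : t < T ->
  \near t, control ((T, c) :: l) t = c.
Proof.
by move=> tT; near=> x; rewrite /= ifT//; near: x; exact: lt_nbhsl.
Unshelve. all: by end_near. Qed.

Lemma near_control_gt T c l t : T < t ->
  \near t, control ((T, c) :: l) t = control l (t - T).
Proof.
move=> tT; near=> x; rewrite /= ifF//; apply/negbTE; rewrite -leNgt ltW//.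
by near: x; exact: lt_nbhsr.
Unshelve. all: by end_near. Qed.

Lemma near_curve_lt T c l v t : t < T ->
  \near t, curve ((T, c) :: l) v t = flow c t v.
Proof.
by move=> tT; near=> x; rewrite /= ifT//; near: x; exact: lt_nbhsl.
Unshelve. all: by end_near. Qed.

Lemma near_curve_gt T c l v t : T < t ->
  \near t, curve ((T, c) :: l) v t = curve l (flow c T v) (t - T).
Proof.
move=> tT; near=> x; rewrite /= ifF//; apply/negbTE; rewrite -leNgt ltW//.
by near: x; exact: lt_nbhsr.
Unshelve. all: by end_near. Qed.

Lemma continuous_control_lt T c l t : t < T ->
  {for t, continuous (control ((T, c) :: l))}.
Proof.
move=> tT; apply: (near_eq_continuous_at (f := cst c)); last first.
  exact: cst_continuous.
by apply: filterS (near_control_lt c l tT).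
Qed.

Lemma continuous_control_gt T c l t : T < t ->
  {for t, continuous (control ((T, c) :: l))} <->
  {for t - T, continuous (control l)}.
Proof.
move=> Tt; have E := near_control_gt c l Tt; rewrite -(continuous_at_subr _ T).
by split; apply: near_eq_continuous_at => //; apply: filterS E.
Qed.

Lemma finite_discontinuities_control l :
  finite_set (discontinuities (control l)).
Proof.
elim: l => [|[T c] l IH].
  apply: (sub_finite_set _ (finite_set0 _)) => t /=; apply.
  exact: cst_continuous.
(* Prefixing a piece shifts the earlier discontinuities by [T] and adds at most the switching time
   itself. *)
apply: (@sub_finite_set _ _
  (T |` (fun t => t + T) @` discontinuities (control l))).
  move=> t dt; have [tT|Tt|->] := ltgtP t T; last by left.
    by case: dt; exact: continuous_control_lt.
  right; exists (t - T); last by rewrite subrK.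
  by move=> /(continuous_control_gt c l Tt).
by rewrite finite_setU; split; [exact: finite_set1|exact: finite_image].
Qed.

(** The left limit at [T] is [c], while the value there is [control l 0]. Consecutive pieces may
    carry the same value, so a switching time need not be a discontinuity. *)
Lemma control_continuous_switch T c l : all (fun Tc => 0 < Tc.1) l ->
  {for T, continuous (control ((T, c) :: l))} -> control l 0 = c.
Proof.
move=> lpos /cvg_at_left_filter; rewrite /= ltxx subrr => cu.
apply: (cvg_unique _ cu) => //.
apply: cvg_near_cst; near=> x; rewrite ifT//; near: x; exact: nbhs_left_lt.
Unshelve. all: by end_near. Qed.

Lemma continuous_curve l v : all (fun Tc => 0 < Tc.1) l ->
  continuous (curve l v).
Proof.
elim: l v => [|[T c] l IH] v /=; first by move=> _; exact: continuous_flow.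
move=> /andP[T0 lpos] t; have [tT|Tt|tT] := ltgtP t T.
- apply: (near_eq_continuous_at _ (@continuous_flow c v t)).
  by apply: filterS (near_curve_lt c l v tT).
- apply: near_eq_continuous_at; last first.
    by apply/(continuous_at_subr _ T); exact: (IH (flow c T v) lpos).
  by apply: filterS (near_curve_gt c l v Tt).
(* At the switching time both one-sided limits are [flow c T v], the starting point of the remaining
   curve. *)
- subst t; apply/left_right_continuousP; rewrite ltxx subrr curve0//; split.
    have := cvg_at_left_filter (@continuous_flow c v T).
    apply: cvg_trans; apply: near_eq_cvg; near=> x.
    by rewrite ifT//; near: x; exact: nbhs_left_lt.
  have : {for T, continuous (fun t => curve l (flow c T v) (t - T))}.
    by apply/(continuous_at_subr _ T); exact: IH.
  move=> /cvg_at_right_filter; rewrite subrr curve0//.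
  apply: cvg_trans; apply: near_eq_cvg; near=> x.
  by rewrite ifF//; apply/negbTE; rewrite -leNgt; near: x; exact: nbhs_right_ge.
Unshelve. all: by end_near. Qed.

Lemma is_derive_curve l v t : all (fun Tc => 0 < Tc.1) l ->
  {for t, continuous (control l)} ->
  is_derive t 1 (curve l v) (A *m (curve l v t - control l t *: p)).
Proof.
elim: l v t => [|[T c] l IH] v t; first by move=> _ _; exact: is_derive_flow.
move=> /andP[T0 lpos] ut; have [tT|Tt|tT] := ltgtP t T.
- rewrite /= tT; apply: near_eq_is_derive (is_derive_flow c t v).
  by apply: filterS (near_curve_lt c l v tT).
- rewrite [control _ t]/= [curve _ _ t]/= ltNge ltW//=.
  apply: near_eq_is_derive; last first.
    apply/is_derive_subr/IH => //; exact/(continuous_control_gt c l Tt).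
  by apply: filterS (near_curve_gt c l v Tt).
(* Continuity makes the next value equal to [c], so by the semigroup law [flowD] the curve follows
   the single flow of [c] on both sides of [T]. *)
- subst t; have c0E := control_continuous_switch lpos ut.
  rewrite [control _ T]/= [curve _ _ T]/= ltxx subrr c0E curve0//.
  apply: near_eq_is_derive (is_derive_flow c T v).
  have [d d0 dP] := control_initial lpos.
  near=> x; rewrite /=; case: ifPn => // _.
  have [|_ ->] := dP (x - T).
    by rewrite ltrBlDr; near: x; apply: lt_nbhsl; rewrite ltrDr.
  by rewrite c0E -flowD subrK.
Unshelve. all: by end_near. Qed.

Lemma control_curveP (B : set R) l v :
  all (fun Tc => 0 < Tc.1) l -> B c0 -> (forall Tc, Tc \in l -> B Tc.2) ->
  control_functions B (control l) /\
  solution A (- (A *m p)) (control l) v (curve l v).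
Proof.
move=> lpos Bc0 Bl; split; split.
- split=> [a b|a b].
    apply: sub_finite_set (finite_discontinuities_control l); exact: subIsetr.
  exact/finite_range_constant/finite_range_control.
- by move=> t; exact: control_in.
- exact: continuous_curve.
- exact: curve0.
- move=> s /contrapT us; apply: is_derive_eq (is_derive_curve v lpos us) _.
  by rewrite mulmxBr -scalemxAr scalerN.
Qed.

(** * Steering one point to another *)

(** Reachability by finitely many constant pieces, so that transitivity amounts to appending lists.
    Durations are strictly positive, as the results on [curve] require. *)
Definition steers (B : set R) (v x : 'cV[R]_2) : Prop :=
  exists l, [/\ all (fun Tc => 0 < Tc.1) l, forall Tc, Tc \in l -> B Tc.2 &
    endpoint l v = x].

Lemma steers_refl B v : steers B v v.
Proof. by exists [::]. Qed.

Lemma steers_trans B v x y : steers B v x -> steers B x y -> steers B v y.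
Proof.
move=> [l [lpos Bl <-]] [l' [lpos' Bl' <-]]; exists (l ++ l'); split.
- by rewrite all_cat lpos.
- by move=> Tc; rewrite mem_cat => /orP[/Bl|/Bl'].
- by rewrite /endpoint foldl_cat.
Qed.

Lemma steers_flow (B : set R) c t v : B c -> 0 <= t -> steers B v (flow c t v).
Proof.
move=> Bc; rewrite le_eqVlt => /predU1P[<-|t0].
  by rewrite flow0; exact: steers_refl.
exists [:: (t, c)]; split=> //=; first by rewrite t0.
by move=> Tc; rewrite inE => /eqP->.
Qed.

Lemma steers_positive_orbit (B : set R) v x : B c0 -> steers B v x ->
  positive_orbit A (- (A *m p)) B v x.
Proof.
move=> Bc0 [l [lpos Bl <-]]; have [s s0 <-] := curve_endpoint v lpos.
have [Bu uv] := control_curveP v lpos Bc0 Bl.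
by exists s, (control l), (curve l v).
Qed.

(** A half-turn about [c *: p] is the point reflection v -> 2 c p - v, and two point reflections
    compose to a translation. *)
Lemma steers_two_half_turns (B : set R) c c' v : B c -> B c' ->
  steers B v (v + (2 * (c' - c)) *: p).
Proof.
move=> Bc Bc'; have T0 : 0 <= pi / w by rewrite divr_ge0 ?pi_ge0 // ltW.
have := steers_trans (steers_flow v Bc T0) (steers_flow _ Bc' T0).
rewrite /flow !rot_half_turn; congr steers.
by apply/matrixP => i j; rewrite !mxE; ring.
Qed.

Lemma steers_translate (umin umax c : R) v : umin < umax ->
  steers `[umin, umax] v (v + c *: p).
Proof.
move=> uu; set d := umax - umin; have d0 : 0 < d by rewrite subr_gt0.
have step e x : `|e| <= d -> steers `[umin, umax] x (x + e *: p).
  (* Half-turns translate by twice the gap between the control values, so the gap is |e| / 2, which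
     fits in the interval; the sign of [e] decides which value comes first. *)
  move=> ed; have [e0|e0] := leP 0 e.
    rewrite ger0_norm// in ed.
    have := @steers_two_half_turns `[umin, umax] umin (umin + e / 2) x.
    rewrite /= !in_itv/= [umin + _]addrC addrK mulrCA divff// mulr1.
    by apply; apply/andP; split; rewrite /d in ed; lra.
  rewrite ltr0_norm// in ed.
  have := @steers_two_half_turns `[umin, umax] (umin - e / 2) umin x.
  rewrite /= !in_itv/= subKr mulrCA divff// mulr1.
  by apply; apply/andP; split; rewrite /d in ed; lra.
have iter n e x : `|e| <= d -> steers `[umin, umax] x (x + (e *+ n) *: p).
  move=> ed; elim: n => [|n IH].
    by rewrite mulr0n scale0r addr0; exact: steers_refl.
  apply: steers_trans IH _; rewrite mulrSr scalerDl addrA; exact: step.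
(* The number of equal steps: [n] exceeds |c| / d, so each step [c / n%:R] has size at most [d]. *)
pose n := (Num.truncn (`|c| / d)).+1.
have := iter n (c / n%:R) v; rewrite -[_ / _ *+ n]mulr_natr divfK ?pnatr_eq0//.
apply; rewrite normrM normfV normr_nat ler_pdivrMr ?ltr0n//.
by rewrite mulrC -ler_pdivrMr// ltW// truncnS_gt.
Qed.

Hypothesis span_pAp : forall x, exists a b, x = a *: p + b *: (A *m p).

Lemma rot_from_line x :
  exists2 t, 0 <= t <= pi / w & exists a, rot t (a *: p) = x.
Proof.
have w0 : w != 0 by rewrite gt_eqF.
have [a [b ->]] := span_pAp x.
(* [rot] divides the sine by [w], hence the coordinate [b * w]; dividing the angle by [w] turns it
   into a time. *)
have [t /andP[t0 tpi] [r [ar br]]] := polar_coordinates a (b * w).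
exists (t / w).
  by rewrite (ler_pM2r (_ : 0 < w^-1)) ?invr_gt0// tpi divr_ge0// ltW.
exists r; rewrite /rot mulrC divfK// -scalemxAr !scalerA mulrC -ar.
by congr (_ + _ *: _); rewrite mulrAC [_ * r]mulrC -br mulfK.
Qed.

Lemma rot_to_line x : exists2 t, 0 <= t & exists a, rot t x = a *: p.
Proof.
have [t /andP[_ tw] [a ax]] := rot_from_line x.
(* Since [x] is [a *: p] rotated for time [t], completing the half-turn brings it to [- a *: p]. *)
exists (pi / w - t); first by rewrite subr_ge0.
by exists (- a); rewrite -ax -rotD subrK rot_half_turn scaleNr.
Qed.

Lemma steersT (umin umax : R) v x : umin < umax -> steers `[umin, umax] v x.
Proof.
move=> uu; have Bu : `[umin, umax]%classic umin by rewrite /= bound_itvE ltW.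
(* All rotations are about [umin *: p]. Measured from this centre along the line, [v] is brought to
   [a] and [x] is reached from [b], which leaves a translation by [b - a]. *)
have [s s0 [a sa]] := rot_to_line (v - umin *: p).
have [t /andP[t0 _] [b tb]] := rot_from_line (x - umin *: p).
apply: steers_trans (steers_flow v Bu s0) _.
apply: steers_trans (steers_translate (b - a) _ uu) _.
have E : flow umin t (umin *: p + b *: p) = x.
  by rewrite /flow addrAC subrr add0r tb addrC subrK.
have := steers_flow (umin *: p + b *: p) Bu t0; rewrite E.
have -> // : flow umin s v + (b - a) *: p = umin *: p + b *: p.
by rewrite /flow sa -addrA -scalerDl [a + _]addrC subrK.
Qed.

End harmonic_control.

(** * Linear algebra of a traceless matrix with positive determinant *)

Section traceless.
Variables (R : realType) (A : 'M[R]_2).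
Hypotheses (trA : \tr A = 0) (detA : 0 < \det A).

Let lift01 : lift 0 0 = 1 :> 'I_2. Proof. exact: val_inj. Qed.
Let lift10 : lift 1 0 = 0 :> 'I_2. Proof. exact: val_inj. Qed.

Let ord2 (i : 'I_2) : i = 0 \/ i = 1.
Proof. by case: i => -[|[|//]] i2; [left|right]; apply: val_inj. Qed.

Let A11 : A 1 1 = - A 0 0.
Proof.
apply/eqP; rewrite -addr_eq0 addrC -[X in _ == X]trA.
by rewrite /mxtrace big_ord_recl big_ord1 lift01.
Qed.

Let detE : \det A = - (A 0 0 ^+ 2 + A 0 1 * A 1 0).
Proof.
rewrite (expand_det_row _ 0) big_ord_recl big_ord1 /cofactor !det_mx11 !mxE.
by rewrite lift01 lift10 A11 /= expr0 expr1; ring.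
Qed.

(** Cayley-Hamilton, A^2 - (tr A) A + det A = 0, with zero trace. *)
Lemma traceless_sqr : A *m A = - (\det A)%:M.
Proof.
apply/matrixP => i j; rewrite !mxE big_ord_recl big_ord1 detE lift01.
by case: (ord2 i) => ->; case: (ord2 j) => ->; rewrite /= ?A11; ring.
Qed.

(* The determinant of the columns [p] and [A *m p] is a definite quadratic form
   in [p]: its discriminant is [- 4 * \det A]. *)
Lemma traceless_span (p x : 'cV[R]_2) : p != 0 ->
  exists a b, x = a *: p + b *: (A *m p).
Proof.
move=> p_neq0; pose q y := (A *m p) y 0.
have q0 : q 0 = A 0 0 * p 0 0 + A 0 1 * p 1 0.
  by rewrite /q !mxE big_ord_recl big_ord1 lift01.
have q1 : q 1 = A 1 0 * p 0 0 - A 0 0 * p 1 0.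
  by rewrite /q !mxE big_ord_recl big_ord1 lift01 A11 mulNr.
have D0 : p 0 0 * q 1 - p 1 0 * q 0 != 0.
  apply: contra p_neq0 => /eqP D0; apply/eqP.
  (* Completing the square in the quadratic form after multiplying it by [A 1 0]. *)
  have : (A 1 0 * p 0 0 - A 0 0 * p 1 0) ^+ 2 + \det A * p 1 0 ^+ 2 = 0.
    by rewrite -[RHS](mulr0 (A 1 0)) -D0 q0 q1 detE; ring.
  move/eqP; rewrite paddr_eq0 ?(mulr_ge0 (ltW detA) (sqr_ge0 _)) ?sqr_ge0//.
  rewrite [\det A * _ == 0]mulf_eq0 (gt_eqF detA) /= !sqrf_eq0.
  move=> /andP[+ /eqP p1]; rewrite p1 mulr0 subr0 mulf_eq0 => /orP[/eqP a10|/eqP p00].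
    (* With [A 1 0 = 0] the determinant would be - (A 0 0)^2, which is not positive. *)
    by move: detA; rewrite detE a10 mulr0 addr0 oppr_gt0 ltNge sqr_ge0.
  by apply/matrixP => i j; rewrite !mxE ord1; case: (ord2 i) => ->.
(* Cramer's rule for the columns [p] and [A *m p]. *)
exists ((x 0 0 * q 1 - x 1 0 * q 0) / (p 0 0 * q 1 - p 1 0 * q 0)).
exists ((p 0 0 * x 1 0 - p 1 0 * x 0 0) / (p 0 0 * q 1 - p 1 0 * q 0)).
apply/matrixP => i j.
rewrite [j]ord1 mxE [X in _ + X]mxE [X in X + _]mxE -/(q i).
by case: (ord2 i) => ->; field.
Qed.

End traceless.

(** * The whole plane as a control set *)

Theorem theorem3p3 (R : realType) (A : 'M[R]_2) (eta : 'cV[R]_2)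
    (umin umax : R) (heta : eta != 0) (hu : umin < umax)
    (htr : \tr A = 0) (hdet : 0 < \det A) :
  controllable A eta `[umin, umax].
Proof.
pose w := Num.sqrt (\det A).
have w0 : 0 < w by rewrite sqrtr_gt0.
have AA : A *m A = - (w ^+ 2)%:M by rewrite sqr_sqrtr ?ltW// traceless_sqr.
(* This is - A^-1 eta, because A^-1 = - w^-2 A. *)
pose p := w ^- 2 *: (A *m eta).
have wn0 : w ^+ 2 != 0 by rewrite expf_neq0// gt_eqF.
have Ap : eta = - (A *m p).
  by rewrite /p -scalemxAr (mulmxAA AA) scalerN opprK scalerK.
have p0 : p != 0.
  by apply: contra heta => /eqP p0; rewrite Ap p0 mulmx0 oppr0.
have Bu : `[umin, umax]%classic umin by rewrite /= bound_itvE ltW.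
split=> // [v _|v _ x _|E _ _ TE].
(* Any admissible control stays in the whole plane; the empty list gives the constant control
   [umin]. *)
- have nilB (Tc : R * R) : Tc \in [::] -> `[umin, umax]%classic Tc.2 by [].
  have [Bc sc] := control_curveP p w0 AA (l := [::]) v isT Bu nilB.
  by exists (control umin [::]), (curve A w p umin [::] v); rewrite Ap.
(* Every point is reached exactly, so it already lies in the orbit itself. *)
- apply: subset_closure; rewrite Ap.
  apply: (steers_positive_orbit w0 AA Bu).
  by apply: (steersT w0 AA) => // y; exact: traceless_span.
- by apply/seteqP; split.
Qed.
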